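(* Let $a,k,r$ be non-negative integers with $a<k<r$. Then for every integer $n\ge r$, \[ g^{(k)}_{\{0,1,\dots,a\}}(n)\ \ge\ g^{(r)}_{\{0,1,\dots,a\}}(n)\ \ge\ g^{(k)}_{\{0,1,\dots,a\}}(n-r+k), \] and for every integer $n\ge r-k$, \[ h^{(k)}_{\{0,1,\dots,a\}}(n)\ \ge\ h^{(r)}_{\{0,1,\dots,a\}}(n)\ \ge\ h^{(k)}_{\{0,1,\dots,a\}}(n-r+k). \]
   Context: An $r$-uniform hypergraph is a finite vertex set with a family of $r$-element subsets (hyperedges). A vertex is isolated if it lies in no hyperedge. Given a non-empty set $A$ of non-negative integers, a set $S$ of vertices is an $A$-transversal of an $r$-uniform hypergraph $\mathcal{H}$ if $|H\cap S|\in A$ for every hyperedge $H$; it is maximal if it is not a proper subset of another $A$-transversal. For $n\ge r$, $g^{(r)}_A(n)$ denotes the maximum number of $A$-transversals in an $r$-uniform hypergraph on $n$ vertices with no isolated vertices, and $h^{(r)}_A(n)$ denotes the maximum number of maximal $A$-transversals in an $r$-uniform hypergraph on $n$ vertices (isolated vertices allowed). *)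

(* Defs.v *)
From mathcomp Require Import all_boot.

Set Implicit Arguments.
Unset Strict Implicit.
Unset Printing Implicit Defensive.

(* A hypergraph on the vertex set T is given by its set E of hyperedges. *)

Definition uniform (T : finType) (r : nat) (E : {set {set T}}) : bool :=
  [forall H in E, #|H| == r].

Definition isolated (T : finType) (E : {set {set T}}) (v : T) : bool :=
  [forall H in E, v \notin H].

Definition Atransversal (T : finType) (A : pred nat) (E : {set {set T}})
    (S : {set T}) : bool :=
  [forall H in E, A #|H :&: S|].

Definition maximal_Atransversal (T : finType) (A : pred nat) (E : {set {set T}})
    (S : {set T}) : bool :=
  maxset (Atransversal A E) S.

(* For 0 < r <= n the complete r-uniform hypergraph has no isolated vertices,
   so the range of this maximum is nonempty and the default value 0 of \max
   plays no role. *)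
Definition g (r : nat) (A : pred nat) (n : nat) : nat :=
  \max_(E : {set {set 'I_n}} | uniform r E && [forall v, ~~ isolated E v])
     #|[set S | Atransversal A E S]|.

(* The range contains the edgeless hypergraph for all r and n. *)
Definition h (r : nat) (A : pred nat) (n : nat) : nat :=
  \max_(E : {set {set 'I_n}} | uniform r E)
     #|[set S | maximal_Atransversal A E S]|.

Definition upto (a : nat) : pred nat := [pred i | i <= a].

(* Main.v *)
Require Import Defs.
From mathcomp Require Import all_boot.

Set Implicit Arguments.
Unset Strict Implicit.
Unset Printing Implicit Defensive.

(** The upper bounds hold because, as [a < k], an [r]-uniform hypergraph and the
    [k]-uniform hypergraph of all [k]-subsets of its hyperedges have the same
    transversals.  For the lower bounds, add [r - k] new vertices to every
    hyperedge of a [k]-uniform hypergraph: each old transversal is still a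
    transversal, and a maximal one extends to a maximal one whose trace on the
    old vertices is unchanged. *)

(** Elements of [B] can be added to [A] one at a time. This serves to choose shadow edges that
    contain prescribed vertices. *)
Lemma exists_card_between (T : finType) (A B : {set T}) (k : nat) :
  A \subset B -> #|A| <= k <= #|B| ->
  exists C : {set T}, [/\ A \subset C, C \subset B & #|C| = k].
Proof.
move=> sAB /andP[]; elim: k => [|k IHk].
  by rewrite leqn0 => /eqP A0 _; exists A; split.
rewrite leq_eqVlt => /orP[/eqP <- _|leAk ltkB]; first by exists A; split.
have [C [sAC sCB cardC]] := IHk leAk (ltnW ltkB).
have /properP[_ [x xB xNC]] : C \proper B by rewrite properEcard sCB cardC.
exists (x |: C); split.
- exact: subset_trans sAC (subsetUr _ _).
- by rewrite subUset sub1set xB.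
- by rewrite cardsU1 xNC cardC.
Qed.

Lemma card_imset_rshiftT (m d : nat) : #|@rshift m d @: [set: 'I_d]| = d.
Proof. by rewrite card_imset ?cardsT ?card_ord //; apply: rshift_inj. Qed.

Section Shadow.

Context {T : finType}.
Implicit Types (E : {set {set T}}) (S : {set T}) (v : T).

Definition shadow (k : nat) E : {set {set T}} :=
  [set K : {set T} | (#|K| == k) && [exists H in E, K \subset H]].

Lemma uniform_shadow k E : uniform k (shadow k E).
Proof. by apply/forall_inP => K; rewrite inE => /andP[]. Qed.

(** If a hyperedge [H] meets [S] in more than [a] vertices, choose [a.+1] of them. Since
    [a.+1 <= k <= r], they lie in some [k]-subset of [H], a shadow edge violating the bound. The
    converse is monotonicity of [#|_ :&: S|]. *)
Lemma Atransversal_shadow a k r E S : a < k <= r -> uniform r E ->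
  Atransversal (upto a) (shadow k E) S = Atransversal (upto a) E S.
Proof.
move=> /andP[ltak lekr] /forall_inP unifE; apply/forall_inP/forall_inP => trS.
  move=> H HE; rewrite /upto inE leqNgt; apply/negP => ltaHS.
  have [|X [_ sXHS cardX]] := @exists_card_between _ _ _ a.+1 (sub0set (H :&: S)).
    by rewrite cards0.
  have [sXH sXS] : X \subset H /\ X \subset S by apply/andP; rewrite -subsetI.
  have [|K [sXK sKH cardK]] := @exists_card_between _ _ _ k sXH.
    by rewrite cardX ltak (eqP (unifE H HE)).
  have /trS : K \in shadow k E.
    by rewrite inE cardK eqxx; apply/exists_inP; exists H.
  rewrite /upto inE leqNgt => /negP[].
  by rewrite -cardX subset_leq_card // subsetI sXK.
move=> K; rewrite inE => /andP[_ /exists_inP[H HE sKH]].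
have := trS H HE; rewrite /upto !inE; apply: leq_trans.
exact/subset_leq_card/setSI.
Qed.

Lemma isolated_shadow k r E v : 0 < k <= r -> uniform r E ->
  ~~ isolated E v -> ~~ isolated (shadow k E) v.
Proof.
move=> /andP[k_gt0 lekr] /forall_inP unifE /forall_inPn[H HE]; rewrite negbK => vH.
have [||K [svK sKH cardK]] := @exists_card_between _ [set v] H k.
- by rewrite sub1set.
- by rewrite cards1 k_gt0 (eqP (unifE H HE)).
apply/forall_inPn; exists K; last by rewrite negbK -sub1set.
by rewrite inE cardK eqxx; apply/exists_inP; exists H.
Qed.

End Shadow.

Section Extension.

Context {m d : nat}.
Implicit Types (E : {set {set 'I_m}}) (H S : {set 'I_m}) (U : {set 'I_(m + d)}).

(** The old vertices are the image of [lshift d]. All extended edges share the same [d] new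
    vertices, the image of [rshift m]. *)
Definition extend_edge H : {set 'I_(m + d)} :=
  lshift d @: H :|: @rshift m d @: [set: 'I_d].

Definition extend E : {set {set 'I_(m + d)}} := extend_edge @: E.

Lemma lshift_extend_edge H i : (lshift d i \in extend_edge H) = (i \in H).
Proof.
rewrite inE (mem_imset _ _ (@lshift_inj _ _)) orbC.
by case: imsetP => // -[j _ /eqP]; rewrite eq_lrshift.
Qed.

Lemma rshift_extend_edge H j : rshift m j \in extend_edge H.
Proof. by rewrite inE imset_f ?orbT. Qed.

Lemma card_extend_edge H : #|extend_edge H| = #|H| + d.
Proof.
rewrite cardsU card_imset_rshiftT (card_imset _ (@lshift_inj _ _)).
rewrite disjoint_setI0 ?cards0 ?subn0 //.
apply/pred0P => x /=; apply/negP => /andP[/imsetP[i _ ->] /imsetP[j _ /eqP]].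
by rewrite eq_lrshift.
Qed.

Lemma uniform_extend k E : uniform k E -> uniform (k + d) (extend E).
Proof.
move=> /forall_inP unifE; apply/forall_inP => _ /imsetP[H HE ->].
by rewrite card_extend_edge (eqP (unifE H HE)).
Qed.

Lemma isolated_extend E : 0 < m -> (forall v, ~~ isolated E v) ->
  forall v, ~~ isolated (extend E) v.
Proof.
move=> m_gt0 covE v; rewrite -(splitK v); case: (split v) => [i|j] /=.
  have /forall_inPn[H HE] := covE i; rewrite negbK => iH.
  apply/forall_inPn; exists (extend_edge H); first exact: imset_f.
  by rewrite negbK lshift_extend_edge.
(* A new vertex lies in every extended edge, so one edge suffices; an old vertex, available as
   [0 < m], provides it. *)
have /forall_inPn[H HE _] := covE (Ordinal m_gt0).
apply/forall_inPn; exists (extend_edge H); first exact: imset_f.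
by rewrite negbK rshift_extend_edge.
Qed.

(** A set of old vertices meets an extended edge only in old vertices, so no intersection size
    changes, whatever [A] is. *)
Lemma Atransversal_extend_lshift A E S :
  Atransversal A (extend E) (lshift d @: S) = Atransversal A E S.
Proof.
have cardI H : #|extend_edge H :&: lshift d @: S| = #|H :&: S|.
  rewrite -[RHS](card_imset _ (@lshift_inj m d)); apply: eq_card => x.
  rewrite -(splitK x) !inE; case: (split x) => [i|j] /=.
    by rewrite -in_setU lshift_extend_edge !(mem_imset _ _ (@lshift_inj _ _)) inE.
  rewrite [X in _ && X](_ : _ = false) ?andbF.
    by apply/esym/imsetP => -[i _ /eqP]; rewrite eq_rlshift.
  by apply/imsetP => -[i _ /eqP]; rewrite eq_rlshift.
apply/forall_inP/forall_inP => trS H.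
  by move=> HE; rewrite -cardI; apply/trS/imset_f.
by move=> /imsetP[K KE ->]; rewrite cardI; apply: trS.
Qed.

(** Discarding the new vertices can only shrink an intersection, and [upto a] is downward closed. *)
Lemma Atransversal_extend_preim a E U :
  Atransversal (upto a) (extend E) U ->
  Atransversal (upto a) E (lshift d @^-1: U).
Proof.
move=> /forall_inP trU; apply/forall_inP => H HE.
have := trU _ (imset_f _ HE); rewrite /upto !inE; apply: leq_trans.
rewrite -(card_imset _ (@lshift_inj m d)); apply/subset_leq_card/subsetP => x.
move=> /imsetP[i]; rewrite inE [i \in _ @^-1: _]inE => /andP[iH iU] ->.
by rewrite in_setI lshift_extend_edge iH.
Qed.

(** Take any maximal [U] above the copy of [S]. Its trace on the old vertices is a transversal
    containing [S], hence equals [S] by maximality. *)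
Lemma maximal_Atransversal_extend a E S :
  maximal_Atransversal (upto a) E S ->
  exists2 U, maximal_Atransversal (upto a) (extend E) U & S = lshift d @^-1: U.
Proof.
move=> /maxsetP[trS maxS].
have := Atransversal_extend_lshift (upto a) E S.
rewrite trS => /maxset_exists[U maxU sSU]; exists U => //.
apply/esym/maxS; first exact/Atransversal_extend_preim/(maxsetp maxU).
by apply/subsetP => i iS; rewrite inE (subsetP sSU) ?imset_f.
Qed.

End Extension.

Lemma leq_g_shadow a k r n : a < k <= r -> g r (upto a) n <= g k (upto a) n.
Proof.
move=> akr; have /andP[ltak lekr] := akr.
apply/bigmax_leqP => E /andP[unifE /forallP covE].
rewrite (eq_card (_ : _ =i [set S | Atransversal (upto a) (shadow k E) S])); last first.
  by move=> S; rewrite !inE (Atransversal_shadow _ akr unifE).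
apply: (@leq_bigmax_cond _ _ (fun F => #|[set S | Atransversal (upto a) F S]|)).
rewrite uniform_shadow; apply/forallP => v; apply: isolated_shadow unifE _ => //.
by rewrite lekr (leq_ltn_trans _ ltak).
Qed.

Lemma leq_h_shadow a k r n : a < k <= r -> h r (upto a) n <= h k (upto a) n.
Proof.
move=> akr; apply/bigmax_leqP => E unifE.
rewrite (eq_card (_ : _ =i [set S | maximal_Atransversal (upto a) (shadow k E) S])).
  apply: (@leq_bigmax_cond _ _ (fun F => #|[set S | maximal_Atransversal _ F S]|)).
  exact: uniform_shadow.
(* Maximality depends only on the family of transversals, which [E] and its shadow share. *)
move=> S; rewrite !inE; apply: maxset_eq => U.
by rewrite (Atransversal_shadow _ akr unifE).
Qed.

Lemma leq_g_extend A k m d : 0 < m -> g k A m <= g (k + d) A (m + d).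
Proof.
move=> m_gt0; apply/bigmax_leqP => E /andP[unifE /forallP covE].
apply: leq_trans (leq_bigmax_cond (extend E) _); last first.
  by rewrite uniform_extend //; apply/forallP/isolated_extend.
(* Copying along [lshift d] injects the transversals of [E] into those of [extend E]. *)
rewrite -(card_imset _ (imset_inj (@lshift_inj m d))).
apply/subset_leq_card/subsetP => _ /imsetP[S trS ->].
by move: trS; rewrite !inE Atransversal_extend_lshift.
Qed.

Lemma leq_h_extend a k m d : h k (upto a) m <= h (k + d) (upto a) (m + d).
Proof.
apply/bigmax_leqP => E unifE.
apply: leq_trans (leq_bigmax_cond (extend E) (uniform_extend unifE)).
set M := [set U | _ (extend E) U].
(* The count goes through traces: those of the sets in [M] include every maximal transversal of [E],
   and possibly other sets. *)
apply: leq_trans (leq_imset_card (fun U : {set _} => lshift d @^-1: U) (mem M)).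
apply/subset_leq_card/subsetP => S; rewrite inE.
move=> /(@maximal_Atransversal_extend m d)[U maxU ->].
by apply/imsetP; exists U; rewrite ?inE.
Qed.

Theorem theorem4 (a k r : nat) (hak : a < k) (hkr : k < r) :
  (forall n : nat, r <= n ->
     g k (upto a) n >= g r (upto a) n /\
     g r (upto a) n >= g k (upto a) (n - (r - k))) /\
  (forall n : nat, r - k <= n ->
     h k (upto a) n >= h r (upto a) n /\
     h r (upto a) n >= h k (upto a) (n - (r - k))).
Proof.
have akr : a < k <= r by rewrite hak ltnW.
have def_r : k + (r - k) = r by rewrite subnKC // ltnW.
split=> n len; split; [exact: leq_g_shadow| |exact: leq_h_shadow|].
- have def_n : n - (r - k) + (r - k) = n by rewrite subnK // (leq_trans (leq_subr _ _)).
  (* Here [r <= n] and [0 < k] give [r - k < r <= n], so at least one old vertex remains; the bound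
     on [h] holds even with none. *)
  have m_gt0 : 0 < n - (r - k).
    rewrite subn_gt0; apply: leq_trans len.
    by rewrite ltn_subrL (leq_ltn_trans _ hak) // (leq_ltn_trans _ hkr).
  by have := leq_g_extend (upto a) k (r - k) m_gt0; rewrite def_r def_n.
- by have := leq_h_extend a k (n - (r - k)) (r - k); rewrite def_r subnK.
Qed.
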